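(* Fix $n\ge0$ and a sign $\pm$, and let $d=\dim H_n^\pm$. The eigenvalues of the matrix $\mathcal A_n^\pm(q)$ are given by power series $\lambda(0),\dots,\lambda(d-1)$ in $q$ of the form $\lambda(k)=\sum_{j\ge 2k+1}\lambda(k,j)\,q^j$, where every coefficient $\lambda(k,j)$ is a rational multiple of $\sqrt2$.
   Context: For integers $k\ge0$ put $\alpha_k:=(-4)^{-k}\binom{2k}{k}$. For $m\ge0$ let $\mathcal P_m(x):=\sqrt{(2m)!}\sum_{k=0}^m(-1)^k2^{3k-m}\frac{\prod_{j=0}^{k-1}(j-\frac{ix}{2}+\frac14)}{(2k)!\,(m-k)!}$. Index the coordinates of $\mathbb C^{n+1}$ by $0,\dots,n$ (standard inner product); let $H_n^+$ (resp. $H_n^-$) be the subspace of vectors whose odd-indexed (resp. even-indexed) coordinates vanish. For $\ell\ge0$ let $\eta_\ell\in\mathbb R^{n+1}$ have coordinates $\eta_\ell(m):=\mathcal P_m(-i(\tfrac12+2\ell))$ (these are real) and $\eta_\ell^\pm(m):=\frac{1\pm(-1)^m}{2}\eta_\ell(m)$. Define $\mathcal A_n^\pm(q):=\pm 2^{3/2}\sum_{\ell\ge0}\alpha_\ell\frac{q^{2\ell+1}}{1-q^{2\ell+1}}\,|\eta_\ell^\pm\rangle\langle\eta_\ell^\pm|$, viewed as an operator on $H_n^\pm$ whose entries are power series in $q$, where $|\xi\rangle\langle\eta|$ denotes $v\mapsto\langle\eta,v\rangle\xi$. *)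

(* Defs.v *)
From HB Require Import structures.
From mathcomp Require Import all_boot all_order all_algebra.
From mathcomp Require Import boolp reals complex zify ring.

Set Implicit Arguments.
Unset Strict Implicit.
Unset Printing Implicit Defensive.

Import GRing.Theory Num.Theory.
Local Open Scope ring_scope.

(* Formal power series in one variable q over R.  Equality is extensional and
   units are chosen classically, hence the use of boolp. *)
Record fps (R : Type) := Fps { fpscoef : nat -> R }.

Declare Scope fps_scope.
Delimit Scope fps_scope with fps.
Notation "{ 'fps' R }" := (fps R) (format "{ 'fps'  R }") : type_scope.
Notation "f `[ i ]" := (fpscoef f i)
  (at level 3, i at level 200, left associativity, format "f `[ i ]") : fps_scope.
Local Open Scope fps_scope.

Lemma fpsP (R : Type) (f g : {fps R}) : (forall i, f`[i] = g`[i]) <-> f = g.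
Proof.
split=> [|->//]; case: f g => [f] [g] /= fg.
by congr Fps; apply/funext.
Qed.

HB.instance Definition _ (R : Type) := gen_eqMixin (fps R).
HB.instance Definition _ (R : Type) := gen_choiceMixin (fps R).

Section FpsZmod.
Variable R : zmodType.
Implicit Types f g : {fps R}.

Definition fps0 : {fps R} := Fps (fun=> 0).
Definition fps_opp f : {fps R} := Fps (fun i => - f`[i]).
Definition fps_add f g : {fps R} := Fps (fun i => f`[i] + g`[i]).

Fact fps_addA : associative fps_add.
Proof. by move=> f g h; apply/fpsP => i /=; rewrite addrA. Qed.
Fact fps_addC : commutative fps_add.
Proof. by move=> f g; apply/fpsP => i /=; rewrite addrC. Qed.
Fact fps_add0 : left_id fps0 fps_add.
Proof. by move=> f; apply/fpsP => i /=; rewrite add0r. Qed.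
Fact fps_addN : left_inverse fps0 fps_opp fps_add.
Proof. by move=> f; apply/fpsP => i /=; rewrite addNr. Qed.

HB.instance Definition _ := GRing.isZmodule.Build (fps R)
  fps_addA fps_addC fps_add0 fps_addN.

Lemma coeff0 i : (0 : {fps R})`[i] = 0. Proof. by []. Qed.
Lemma coeffD f g i : (f + g)`[i] = f`[i] + g`[i]. Proof. by []. Qed.
Lemma coeffN f i : (- f)`[i] = - f`[i]. Proof. by []. Qed.
Lemma coeffB f g i : (f - g)`[i] = f`[i] - g`[i]. Proof. by []. Qed.

Lemma coeff_sum (I : Type) (r : seq I) (P : pred I) (F : I -> {fps R}) i :
  (\sum_(k <- r | P k) F k)`[i] = \sum_(k <- r | P k) (F k)`[i].
Proof. by apply: (big_morph (fun f : {fps R} => f`[i])). Qed.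

End FpsZmod.

Section FpsRing.
Variable R : comNzRingType.
Implicit Types f g h : {fps R}.

Definition fpsC (c : R) : {fps R} := Fps (fun i => if i == 0%N then c else 0).
Definition fps_mul f g : {fps R} :=
  Fps (fun i => \sum_(j < i.+1) f`[j] * g`[i - j]).

Fact fps_mulC : commutative fps_mul.
Proof.
move=> f g; apply/fpsP => i /=; rewrite (reindex_inj rev_ord_inj) /=.
by apply: eq_bigr => j _; rewrite subSS subKn ?leq_ord // mulrC.
Qed.

Fact fps_mul_rev f g i :
  (fps_mul f g)`[i] = \sum_(j < i.+1) f`[i - j] * g`[j].
Proof. by rewrite fps_mulC; apply: eq_bigr => j _; rewrite mulrC. Qed.

Fact fps_mul_coef f g i :
  (fps_mul f g)`[i] = \sum_(j < i.+1) f`[j] * g`[i - j].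
Proof. by []. Qed.

Fact fps_mulA : associative fps_mul.
Proof.
move=> f g h; apply/fpsP => i; rewrite [RHS]fps_mul_rev [LHS]fps_mul_coef.
pose coef3 j k := f`[j] * (g`[i - j - k] * h`[k]).
transitivity (\sum_(j < i.+1) \sum_(k < i.+1 | (k <= i - j)%N) coef3 j k).
  apply: eq_bigr => j _; rewrite fps_mul_rev big_distrr /=.
  by rewrite (big_ord_narrow_leq (leq_subr _ _)).
rewrite (exchange_big_dep predT) //; apply: eq_bigr => k _.
transitivity (\sum_(j < i.+1 | (j <= i - k)%N) coef3 j k).
  apply: eq_bigl => j; rewrite -ltnS -(ltnS j) -!subSn ?leq_ord //.
  by rewrite -subn_gt0 -(subn_gt0 j) -!subnDA addnC.
rewrite (big_ord_narrow_leq (leq_subr _ _)) fps_mul_coef big_distrl /=.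
by apply: eq_bigr => j _; rewrite /coef3 -!subnDA addnC mulrA.
Qed.

Fact fps_mul1 : left_id (fpsC 1) fps_mul.
Proof.
move=> f; apply/fpsP => i /=; rewrite big_ord_recl /= subn0 mul1r.
by rewrite big1 ?addr0 // => j _; rewrite mul0r.
Qed.

Fact fps_mulDl : left_distributive fps_mul +%R.
Proof.
move=> f g h; apply/fpsP => i /=; rewrite -big_split.
by apply: eq_bigr => j _; rewrite mulrDl.
Qed.

Fact fps1_neq0 : fpsC 1 != 0.
Proof.
by apply/eqP => /(congr1 (fun f => f`[0])) /= /eqP; rewrite oner_eq0.
Qed.

HB.instance Definition _ := GRing.Zmodule_isComNzRing.Build (fps R)
  fps_mulA fps_mulC fps_mul1 fps_mulDl fps1_neq0.

Lemma coeffM f g i : (f * g)`[i] = \sum_(j < i.+1) f`[j] * g`[i - j].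
Proof. by []. Qed.

Lemma coeff1 i : (1 : {fps R})`[i] = (i == 0%N)%:R.
Proof. by rewrite /=; case: eqP. Qed.

Lemma coeffCM c f i : (fpsC c * f)`[i] = c * f`[i].
Proof.
rewrite coeffM big_ord_recl /= subn0 big1 ?addr0 // => j _.
by rewrite mul0r.
Qed.

Definition fps_unit : pred {fps R} := fun f => `[< exists g, g * f = 1 >].
Definition fps_inv f : {fps R} :=
  if pselect (exists g, g * f = 1) is left fu then projT1 (cid fu) else f.

Fact fps_mulVx : {in fps_unit, left_inverse 1 fps_inv *%R}.
Proof.
move=> f /asboolP fu; rewrite /fps_inv; case: pselect => // fu'.
by case: cid.
Qed.
Fact fps_unitPl f g : g * f = 1 -> fps_unit f.
Proof. by move=> gf; apply/asboolP; exists g. Qed.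
Fact fps_invr_out : {in [predC fps_unit], fps_inv =1 id}.
Proof.
by move=> f /asboolP fu; rewrite /fps_inv; case: pselect.
Qed.

HB.instance Definition _ := GRing.ComNzRing_hasMulInverse.Build (fps R)
  fps_mulVx fps_unitPl fps_invr_out.

Definition fpsX : {fps R} := Fps (fun i => (i == 1%N)%:R).

Lemma coeffXn p i : (fpsX ^+ p)`[i] = (i == p)%:R.
Proof.
elim: p i => [|p IHp] i; first by rewrite expr0 coeff1.
rewrite exprS coeffM; case: i => [|i].
  by rewrite big_ord_recl big_ord0 /= mul0r addr0.
rewrite !big_ord_recl /= mul0r add0r mul1r subSS subn0 IHp eqSS big1 ?addr0 //.
by move=> j _; rewrite mul0r.
Qed.

(* q^p / (1 - q^p) = sum over i >= 1 of q^(p i) *)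
Lemma coeff_lambert p i : (0 < p)%N ->
  (fpsX ^+ p / (1 - fpsX ^+ p))`[i] = ((0 < i) && (p %| i))%N%:R.
Proof.
move=> p_gt0; pose g : {fps R} := Fps (fun i => (p %| i)%N%:R).
have coefXg j : (fpsX ^+ p * g)`[j] = ((0 < j) && (p %| j))%N%:R.
  rewrite coeffM; under eq_bigr do rewrite coeffXn.
  case: (leqP p j) => pj.
    have pj1 : (p < j.+1)%N by [].
    rewrite (bigD1 (Ordinal pj1)) //= eqxx mul1r big1 ?addr0.
      by rewrite (leq_trans p_gt0 pj) /= dvdn_subl.
    by move=> k; rewrite -val_eqE /= => /negPf->; rewrite mul0r.
  rewrite big1 => [|k _].
    case: j pj => // j pj; rewrite /= gtnNdvd //.
  by case: eqP => [kp|]; [have := leq_ord k; rewrite kp leqNgt pj | rewrite mul0r].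
have g_inv : g * (1 - fpsX ^+ p) = 1.
  rewrite mulrBr mulr1 [g * _]mulrC; apply/fpsP => j.
  rewrite coeffB coefXg coeff1 /=; case: j => [|j] /=.
    by rewrite dvdn0 subr0.
  by rewrite subrr.
have u : 1 - fpsX ^+ p \is a GRing.unit by apply: fps_unitPl g_inv.
have -> : (1 - fpsX ^+ p)^-1 = g by apply: (mulIr u); rewrite mulVr.
exact: coefXg.
Qed.

(* The infinite sum of the series F l, where F l is divisible by q^l: only the
   terms l <= i contribute to the coefficient of q^i (see coeff_fps_sum). *)
Definition fps_sum (F : nat -> {fps R}) : {fps R} :=
  Fps (fun i => \sum_(l < i.+1) (F l)`[i]).

Lemma coeff_fps_sum (F : nat -> {fps R}) i N :
  (forall l, (i < l)%N -> (F l)`[i] = 0) -> (i < N)%N ->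
  (fps_sum F)`[i] = (\sum_(l < N) F l)`[i].
Proof.
move=> F0 iN; rewrite coeff_sum /= (big_ord_widen N (fun l => (F l)`[i])) //.
rewrite big_mkcond; apply: eq_bigr => l _; case: ltnP => // il.
by rewrite F0.
Qed.

End FpsRing.

Section FpsIdomain.
Variable R : idomainType.

Fact fps_mulf_eq0 (f g : {fps R}) : f * g = 0 -> (f == 0) || (g == 0).
Proof.
have low (h : {fps R}) : h != 0 ->
    exists2 i, h`[i] != 0 & forall j, (j < i)%N -> h`[j] = 0.
  move=> h0; have ex : exists i, h`[i] != 0.
    apply: contrapT => nex; move/eqP: h0; apply; apply/fpsP => i.
    by apply/eqP; apply/negPn/negP => hi; apply: nex; exists i.
  case: (ex_minnP ex) => i hi mini; exists i => // j ji.
  apply/eqP; apply: contraTT ji => /mini; by rewrite -leqNgt.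
move=> fg0; apply/norP => -[/low[a fa fmin] /low[b gb gmin]].
have /eqP := congr1 (fun h => fpscoef h (a + b)) fg0.
have aab : (a < (a + b).+1)%N by rewrite ltnS leq_addr.
rewrite coeffM coeff0 (bigD1 (Ordinal aab)) //= addKn big1 ?addr0.
  by rewrite mulf_eq0 (negPf fa) (negPf gb).
move=> j; rewrite -val_eqE /= neq_ltn => /orP[ja|aj].
  by rewrite fmin ?mul0r.
rewrite gmin ?mulr0 // ltn_subLR ?leq_ord //.
by rewrite ltn_add2r.
Qed.

HB.instance Definition _ := GRing.ComUnitRing_isIntegral.Build (fps R)
  fps_mulf_eq0.

End FpsIdomain.

(* The eigenvalues, in the fraction field, of a square matrix over a domain are
   the lam k, each repeated according to its algebraic multiplicity. *)
Definition has_eigenvalues (D : idomainType) (p d : nat)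
    (A : 'M[D]_p) (lam : 'I_d -> D) : Prop :=
  (forall mu : {fraction D},
     eigenvalue (map_mx (@tofrac D) A) mu <-> exists k, mu = tofrac (lam k)) /\
  char_poly A = \prod_(k < d) ('X - (lam k)%:P).

Section Operators.
Variable C : numClosedFieldType.

Definition alpha (k : nat) : C := (- 4) ^- k * 'C(2 * k, k)%:R.

Definition calP (m : nat) (x : C) : C :=
  sqrtC (2 * m)`!%:R *
  \sum_(k < m.+1)
    (-1) ^+ k * 2 ^ ((3 * k)%N%:Z - m%:Z) *
    (\prod_(j < k) (j%:R - 'i * x / 2 + 1 / 4)) /
    ((2 * k)`!%:R * (m - k)`!%:R).

Section Fixed.
(* The boolean s encodes the sign: false is +, true is -, that is (-1) ^+ s. *)
Variables (n : nat) (s : bool).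

Definition Hcoords : {set 'I_n.+1} := [set m : 'I_n.+1 | odd m == s].

Definition Hspace : {vspace 'cV[C]_n.+1} :=
  (\sum_(m in Hcoords) <[(delta_mx m 0)%R]>)%VS.

Lemma memHspace (v : 'cV[C]_n.+1) :
  reflect (forall m : 'I_n.+1, odd m = ~~ s -> v m 0 = 0) (v \in Hspace).
Proof.
apply: (iffP idP) => [/memv_sumP[w wH ->] m om|v0].
  rewrite summxE big1 // => k kH; have /vlineP[c ->] := wH k kH.
  rewrite !mxE; case: eqP => [mk|]; last by rewrite mulr0.
  by move: kH; rewrite inE -mk om; case: (s).
rewrite [v]matrix_sum_delta; apply: rpred_sum => m _.
rewrite big_ord1; have [mH|mH] := boolP (m \in Hcoords).
  by apply: rpredZ; apply: (subvP (sumv_sup m mH (subvv _))); exact: memv_line.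
rewrite v0 ?scale0r ?mem0v //.
by move: mH; rewrite inE; case: (odd m) (s) => [] [].
Qed.

Lemma dim_Hspace : \dim Hspace = #|Hcoords|.
Proof.
have Hb : Hspace = <<[seq (delta_mx m 0)%R | m <- enum Hcoords]>>%VS.
  by rewrite span_def big_map big_enum.
pose X := [tuple of [seq (delta_mx m 0 : 'cV[C]_n.+1) | m <- enum Hcoords]].
have -> : Hspace = <<X>>%VS := Hb.
suff /eqnP -> : free X by rewrite size_tuple.
apply/freeP => c c0 i.
have Xi (k : 'I_#|Hcoords|) : X`_k = delta_mx (enum_val k) 0.
  by rewrite (nth_map (enum_val k)) -?cardE -?enum_val_nth.
have := congr1 (fun v : 'cV[C]_n.+1 => v (enum_val i) 0) c0.
rewrite summxE (bigD1 i) //= !mxE Xi mxE !eqxx mulr1 big1 ?addr0 //.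
move=> k ki; rewrite mxE Xi mxE (inj_eq enum_val_inj) eq_sym.
by rewrite (negPf ki) mulr0.
Qed.

Definition eta (l : nat) : 'cV[C]_n.+1 :=
  \col_m calP m (- 'i * (1 / 2 + 2 * l%:R)).

Definition eta_pm (l : nat) : 'cV[C]_n.+1 :=
  \col_m ((1 + (-1) ^+ s * (-1) ^+ m) / 2 * eta l m 0).

(* The matrix of the map sending v to <y, v> x. *)
Definition ketbra (x y : 'cV[C]_n.+1) : 'M[C]_n.+1 :=
  x *m (map_mx Num.conj y)^T.

Definition calA_full : 'M[{fps C}]_n.+1 :=
  \matrix_(a, b)
    (fpsC ((-1) ^+ s * sqrtC 2 ^+ 3) *
     fps_sum (fun l =>
       fpsC (alpha l * ketbra (eta_pm l) (eta_pm l) a b) *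
       (fpsX C ^+ (2 * l + 1) / (1 - fpsX C ^+ (2 * l + 1))))).

(* The operator restricted to Hspace, in the basis of the delta_mx m 0 for m in
   Hcoords, taken in increasing order. *)
Definition calA : 'M[{fps C}]_#|Hcoords| :=
  mxsub (@enum_val _ (mem Hcoords)) (@enum_val _ (mem Hcoords)) calA_full.

End Fixed.

Lemma coeff_calA_full n s (a b : 'I_n.+1) j N : (j < N)%N ->
  (calA_full n s a b)`[j] =
  (-1) ^+ s * sqrtC 2 ^+ 3 *
  \sum_(l < N) alpha l * (eta_pm n s l a 0 * (eta_pm n s l b 0)^*) *
    ((0 < j) && (2 * l + 1 %| j))%N%:R.
Proof.
move=> jN; rewrite mxE coeffCM (coeff_fps_sum _ jN) => [|l jl].
  congr (_ * _); rewrite coeff_sum; apply: eq_bigr => l _.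
  by rewrite coeffCM coeff_lambert ?addn1 // !mxE big_ord1 !mxE.
rewrite coeffCM coeff_lambert ?addn1 //; case: j jl {jN} => [|j] jl.
  by rewrite mulr0.
rewrite gtnNdvd ?andbF ?mulr0 // ltnS; lia.
Qed.

Lemma calA_full_out n s (a b : 'I_n.+1) :
  (a \notin Hcoords n s) || (b \notin Hcoords n s) -> calA_full n s a b = 0.
Proof.
have eta0 l (m : 'I_n.+1) : m \notin Hcoords n s -> eta_pm n s l m 0 = 0.
  rewrite inE mxE -(signr_odd _ m); case: s (odd m) => [] [] //= _;
  by rewrite ?(mulr1, mul1r) subrr !mul0r.
move=> ab; apply/fpsP => j; rewrite (coeff_calA_full _ _ _ (ltnSn j)).
rewrite big1 ?mulr0 // => l _.
by case/orP: ab => /eta0->; rewrite ?conjC0 ?(mul0r, mulr0).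
Qed.

(* In particular eta is real, as claimed. *)
Lemma etaE n l (m : 'I_n.+1) :
  eta n l m 0 = sqrtC (2 * m)`!%:R *
    \sum_(k < m.+1) 2 ^ ((3 * k)%N%:Z - m%:Z) * (l ^_ k)%:R /
      ((2 * k)`!%:R * (m - k)`!%:R).
Proof.
rewrite mxE /calP; congr (_ * _); apply: eq_bigr => k _; congr (_ / _).
rewrite mulrAC mulrC; congr (_ * _).
have -> : \prod_(j < k) (j%:R - 'i * (- 'i * (1 / 2 + 2 * l%:R)) / 2 + 1 / 4)
   = \prod_(j < k) (j%:R - l%:R) :> C.
  apply: eq_bigr => j _; rewrite mulNr mulrN mulrA -expr2 sqrCi.
  by field; rewrite ?pnatr_eq0.
elim: (val k) => [|p IHp]; first by rewrite big_ord0 ffactn0 mulr1.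
rewrite big_ord_recr /= exprSr mulrACA IHp ffactnSr natrM.
case: (leqP p l) => pl; first by rewrite natrB // mulN1r opprB.
by rewrite ffact_small // !mul0r.
Qed.

End Operators.

(* Main.v *)
(* After conjugation by diag (sqrt (2m)!) the operator becomes sqrt 2 times a
   matrix over Q[[q]].  The polynomials P_m have degree m and the parity of m,
   so at the nodes l = 0, ..., d - 1 the vectors eta_l^s form a basis.
   Orthogonalizing this basis over Q gives a matrix N whose entries N_ij have
   order at least 2 max (i, j) + 1, with equality on the diagonal.  For each k,
   Hensel's lemma applied to det (q^(2k+1) y - N), suitably rescaled, gives an
   eigenvalue in Q[[q]] of order exactly 2k + 1; being distinct, these are all
   the eigenvalues. *)
Require Import Defs.
From HB Require Import structures.
From mathcomp Require Import all_boot all_order all_algebra.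
From mathcomp Require Import boolp reals complex zify ring.

Set Implicit Arguments.
Unset Strict Implicit.
Unset Printing Implicit Defensive.

Import Order.TTheory GRing.Theory Num.Theory.
Local Open Scope ring_scope.
Local Open Scope fps_scope.

(** * Power series *)

Definition fps_map (R S : Type) (f : R -> S) (g : {fps R}) : {fps S} :=
  Fps (fun i => f g`[i]).

Section FpsMap.
Variables (R S : comNzRingType) (f : {rmorphism R -> S}).

Fact fps_map_zmod_morphism : zmod_morphism (fps_map f).
Proof. by move=> g h; apply/fpsP => i /=; rewrite rmorphB. Qed.

Fact fps_map_monoid_morphism : monoid_morphism (fps_map f).
Proof.
split; first by apply/fpsP => i /=; case: eqP; rewrite (rmorph0, rmorph1).
move=> g h; apply/fpsP => i /=; rewrite rmorph_sum.
by apply: eq_bigr => j _; rewrite rmorphM.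
Qed.

HB.instance Definition _ := GRing.isZmodMorphism.Build {fps R} {fps S}
  (fps_map f) fps_map_zmod_morphism.
HB.instance Definition _ := GRing.isMonoidMorphism.Build {fps R} {fps S}
  (fps_map f) fps_map_monoid_morphism.

End FpsMap.

Section FpsTheory.
Variable R : comNzRingType.
Implicit Types (f g : {fps R}) (c : R).

(** Reduction modulo q, as a ring morphism: it commutes with evaluation and determinants. *)
Definition fps_const f : R := f`[0].

Fact fps_const_zmod_morphism : zmod_morphism fps_const.
Proof. by move=> f g. Qed.

Fact fps_const_monoid_morphism : monoid_morphism fps_const.
Proof.
by split=> // f g; rewrite /fps_const coeffM big_ord_recl big_ord0 addr0.
Qed.

HB.instance Definition _ := GRing.isZmodMorphism.Build {fps R} R
  fps_const fps_const_zmod_morphism.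
HB.instance Definition _ := GRing.isMonoidMorphism.Build {fps R} R
  fps_const fps_const_monoid_morphism.

Fact fpsC_zmod_morphism : zmod_morphism (@fpsC R).
Proof. by move=> a b; apply/fpsP => i /=; case: eqP; rewrite ?subr0. Qed.

Fact fpsC_monoid_morphism : monoid_morphism (@fpsC R).
Proof.
split=> // a b; apply/fpsP => i; rewrite coeffCM /=.
by case: eqP; rewrite ?mulr0.
Qed.

HB.instance Definition _ := GRing.isZmodMorphism.Build R {fps R}
  (@fpsC R) fpsC_zmod_morphism.
HB.instance Definition _ := GRing.isMonoidMorphism.Build R {fps R}
  (@fpsC R) fpsC_monoid_morphism.

Lemma coeffXnM n f i :
  (fpsX R ^+ n * f)`[i] = if (i < n)%N then 0 else f`[i - n].
Proof.
rewrite coeffM; case: ltnP => ni.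
  rewrite big1 // => j _; rewrite coeffXn; case: eqP => [jn|_].
    by have := ltn_ord j; rewrite jn ltnS leqNgt ni.
  by rewrite mul0r.
rewrite (bigD1 (Ordinal (ni : n < i.+1)%N)) //= coeffXn eqxx mul1r.
rewrite big1 ?addr0 // => j; rewrite -val_eqE /= => /negPf jn.
by rewrite coeffXn jn mul0r.
Qed.

Lemma fps_eq_XnM n f : (forall i, (i < n)%N -> f`[i] = 0) ->
  f = fpsX R ^+ n * Fps (fun i => f`[n + i]).
Proof.
move=> f0; apply/fpsP => i; rewrite coeffXnM; case: ltnP => [/f0 //|ni] /=.
by rewrite subnKC.
Qed.

Lemma coeff_mul_low n f g : (forall i, (i < n)%N -> g`[i] = 0) ->
  forall i, (i < n)%N -> (f * g)`[i] = 0.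
Proof.
by move=> /fps_eq_XnM-> i ni; rewrite mulrCA coeffXnM ni.
Qed.

(** Polynomials are q-adically continuous because [f - g] divides [p.[f] - p.[g]]. This carries
    approximate roots over to their limit. *)
Lemma coeff_horner_congr (p : {poly {fps R}}) f g n :
  (forall i, (i < n)%N -> f`[i] = g`[i]) ->
  forall i, (i < n)%N -> p.[f]`[i] = p.[g]`[i].
Proof.
move=> fg i ni; apply/eqP; rewrite -subr_eq0 -coeffB; apply/eqP.
have [q pq] : exists q, p - p.[g]%:P = q * ('X - g%:P).
  by apply/factor_theorem; rewrite /root !hornerE subrr.
have -> : p.[f] - p.[g] = q.[f] * (f - g).
  by have := congr1 (horner^~ f) pq; rewrite !hornerE.
by apply: coeff_mul_low ni => j jn; rewrite coeffB fg ?subrr.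
Qed.

End FpsTheory.

(** * Hensel's lemma for power series *)

Section Hensel.
Variables (F : fieldType) (h : {poly {fps F}}) (r0 : F).
Let hbar := map_poly (@fps_const F) h.
Hypotheses (h0 : hbar.[r0] = 0) (h1 : hbar^`().[r0] != 0).

Let const_horner (p : {poly {fps F}}) x :
  p.[x]`[0] = (map_poly (@fps_const F) p).[x`[0]].
Proof. by rewrite -[LHS]/(fps_const _) -horner_map. Qed.

(** A Newton step repairing the coefficient of q^(n+1). The slope may stay frozen at [r0]: the
    correction is divisible by q^(n+1), so only the constant term of the derivative acts on that
    coefficient. *)
Let newton n (r : {fps F}) :=
  r - fpsX F ^+ n.+1 * fpsC (h.[r]`[n.+1] / hbar^`().[r0]).
Let approx n := iteri n newton (fpsC r0).

Let approx_low m n i : (i <= n <= m)%N -> (approx m)`[i] = (approx n)`[i].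
Proof.
case/andP=> ni nm; rewrite -(subnK nm); elim: (m - n)%N => // k IHk.
rewrite addSn -[approx _.+1]/(newton _ (approx _)).
by rewrite coeffB coeffXnM ltnS (leq_trans ni) ?leq_addl // subr0.
Qed.

Let approx0 n : (approx n)`[0] = r0.
Proof. by rewrite (@approx_low n 0%N). Qed.

Let approx_root n i : (i <= n)%N -> h.[approx n]`[i] = 0.
Proof.
elim: n i => [|n IHn] i.
  by rewrite leqn0 => /eqP->; rewrite const_horner.
set r := approx n in IHn *; set c := h.[r]`[n.+1] / hbar^`().[r0].
set y := fpsX F ^+ n.+1 * - fpsC c.
have -> : approx n.+1 = r + y by rewrite /y mulrN.
(* Second-order Taylor expansion at [r]: subtracting the value and the linear term kills the
   coefficients of degree 0 and 1, so X^2 divides the rest. *)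
have [q hq] : exists q,
    h \Po ('X + r%:P) - h.[r]%:P - h^`().[r] *: 'X = q * 'X^2.
  pose p := h \Po ('X + r%:P) - h.[r]%:P - h^`().[r] *: 'X.
  exists (drop_poly 2 p).
  rewrite -/p -[LHS](poly_take_drop 2) -[RHS]add0r; congr (_ + _).
  apply/polyP => j; rewrite coef_take_poly coef0; case: j => [|[|j]] //=.
    rewrite /p -horner_coef0 !hornerE horner_comp !hornerE.
    by rewrite subrr subr0.
  rewrite /p !coefB coefC coefZ coefX mulr1 subr0.
  have -> : (h \Po ('X + r%:P))`_1 = (h \Po ('X + r%:P))^`()`_0.
    by rewrite coef_deriv.
  rewrite -horner_coef0 deriv_comp !derivE !hornerE horner_comp !hornerE.
  by rewrite subrr.
have hry : h.[r + y] = h.[r] + h^`().[r] * y + q.[y] * y ^+ 2.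
  have := congr1 (horner^~ y) hq.
  rewrite !hornerE horner_comp !hornerE [y + r]addrC => <-.
  ring.
(* The remainder has order at least 2n + 2 > n + 1 >= i. *)
move=> ni; rewrite hry !coeffD; have -> : (q.[y] * y ^+ 2)`[i] = 0.
  rewrite /y exprMn -exprM mulrCA coeffXnM ifT //; lia.
rewrite addr0 mulrCA coeffXnM; case: ltnP => ni1; first by rewrite IHn ?addr0.
have -> : i = n.+1 by apply/eqP; rewrite eqn_leq ni.
rewrite subnn -rmorphN mulrC coeffCM const_horner approx0 -deriv_map -/hbar.
by rewrite mulNr divfK ?subrr.
Qed.

Lemma hensel : exists2 r : {fps F}, r`[0] = r0 & h.[r] = 0.
Proof.
(* Diagonal limit: coefficient i no longer changes from [approx i] onwards. *)
exists (Fps (fun i => (approx i)`[i])) => //; apply/fpsP => i.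
rewrite coeff0 -(approx_root (leqnn i));
  apply: (@coeff_horner_congr _ _ _ _ i.+1) => //.
by move=> j ji /=; rewrite (@approx_low i j) // leqnn.
Qed.

End Hensel.

(** * Eigenvalues of graded matrices *)

Lemma horner_char_poly (R : comNzRingType) p (A : 'M[R]_p) (x : R) :
  (char_poly A).[x] = \det (x%:M - A).
Proof.
rewrite -[LHS]/(horner_eval x _) -det_map_mx; congr (\det _).
apply/matrixP => i j.
by rewrite !mxE /= /horner_eval hornerD hornerN hornerC hornerMn hornerX.
Qed.

(** The characteristic polynomial is monic of degree [p], so [p] distinct roots split it over the
    fraction field; the factorization descends since [tofrac] is injective. *)
Lemma distinct_roots_eigenvalues (D : idomainType) p (A : 'M[D]_p)
    (lam : 'I_p -> D) :
  injective lam -> (forall k, \det ((lam k)%:M - A) = 0) ->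
  has_eigenvalues A lam.
Proof.
move=> lam_inj lam0.
have charA : char_poly A = \prod_(k < p) ('X - (lam k)%:P).
  apply: (@map_inj_poly _ _ (@tofrac D)); [|by rewrite tofrac0|].
    by move=> x y /eqP; rewrite tofrac_eq => /eqP.
  pose rs := [seq tofrac (lam k) | k <- enum 'I_p].
  have rsE : \prod_(z <- rs) ('X - z%:P) =
      map_poly (@tofrac D) (\prod_(k < p) ('X - (lam k)%:P)).
    rewrite rmorph_prod big_map big_enum; apply: eq_bigr => k _ /=.
    by rewrite rmorphB /= map_polyX map_polyC.
  rewrite -rsE map_char_poly.
  rewrite [LHS](@all_roots_prod_XsubC _ _ rs).
  - by rewrite (monicP (char_poly_monic _)) scale1r.
  - by rewrite size_char_poly size_map size_enum_ord.
  - apply/allP => _ /mapP[k _ ->].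
    by rewrite -map_char_poly /root horner_map horner_char_poly lam0 rmorph0.
  - rewrite uniq_rootsE map_inj_uniq ?enum_uniq // => i j /eqP.
    by rewrite tofrac_eq => /eqP /lam_inj.
split=> // mu; rewrite eigenvalue_root_char -map_char_poly charA rmorph_prod.
have -> : root (\prod_(k < p) map_poly (@tofrac D) ('X - (lam k)%:P)) mu =
    [exists k, mu == tofrac (lam k)].
  rewrite /root horner_prod; apply/prodf_eq0/existsP => -[k].
    move=> _; rewrite rmorphB /= map_polyX map_polyC !hornerE subr_eq0.
    by exists k.
  by exists k => //; rewrite rmorphB /= map_polyX map_polyC !hornerE subr_eq0.
by split=> [/existsP[k /eqP]|[k ->]]; [exists k | apply/existsP; exists k].
Qed.

(* Substituting q^(e k) y for the eigenvalue and dividing row i by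
   q^(min (e i) (e k)) gives a matrix which is lower triangular modulo q, with
   y - N'_kk as its only diagonal entry having a root at N'_kk, where N'_kk is
   the leading coefficient of N_kk; Hensel's lemma lifts this root. *)
Lemma graded_eigenvalue (F : fieldType) p (N : 'M[{fps F}]_p) (e : nat -> nat) :
  {mono e : i j / (i <= j)%N} ->
  (forall (i j : 'I_p) m, (m < e (maxn i j))%N -> (N i j)`[m] = 0) ->
  (forall i : 'I_p, (N i i)`[e i] != 0) ->
  forall k : 'I_p, exists mu : {fps F},
    [/\ \det (mu%:M - N) = 0, forall m, (m < e k)%N -> mu`[m] = 0
      & mu`[e k] != 0].
Proof.
move=> e_mono N_low N_diag k.
pose N' := \matrix_(i, j) (Fps (fun m => (N i j)`[e i + m]) : {fps F}).
pose X := fpsX F.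
have e_lt (i j : nat) : (e i < e j)%N = (i < j)%N by rewrite !ltnNge e_mono.
have NE (i j : 'I_p) : N i j = X ^+ e i * N' i j.
  rewrite mxE; apply: fps_eq_XnM => m mi; apply: N_low.
  by rewrite (leq_trans mi) // e_mono leq_maxl.
have N'_trig (i j : 'I_p) : (i < j)%N -> (N' i j)`[0] = 0.
  by move=> ij; rewrite mxE /= addn0 N_low // e_lt leq_max ij orbT.
pose lo (i : 'I_p) := minn (e i) (e k).
pose H : 'M[{poly {fps F}}]_p := \matrix_(i, j)
  ((i == j)%:R * (X ^+ (e k - lo i))%:P * 'X - (X ^+ (e i - lo i) * N' i j)%:P).
have HbarE i j : map_poly (@fps_const F) (H i j) =
    ((i == j) && (k <= i)%N)%:R * 'X - ((i <= k)%N%:R * (N' i j)`[0])%:P.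
  have Xn0 m : (X ^+ m)`[0] = (m == 0%N)%:R by rewrite coeffXn eq_sym.
  rewrite mxE rmorphB !rmorphM rmorph_nat /= map_polyX !map_polyC /=.
  rewrite /fps_const !Xn0 !subn_eq0 !leq_min !leqnn !e_mono !andbT /=.
  congr (_ * _ - _); case: (i == j); case: (k <= i)%N;
    by rewrite ?mul0r ?mul1r ?mulr0 ?mulr1 ?polyC0.
pose h := \det H.
pose d i := (N' i i)`[0].
have d_neq0 i : d i != 0 by rewrite /d mxE /= addn0.
(* Modulo q the diagonal entry is a nonzero constant for i < k and X for i > k, so the nonzero [d k]
   is a simple root. *)
have hbarE : map_poly (@fps_const F) h = ('X - (d k)%:P) *
    \prod_(i < p | i != k) (if (i < k)%N then - (d i)%:P else 'X).
  rewrite -det_map_mx det_trig; last first.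
    apply/is_trig_mxP => i j ij; rewrite mxE /= HbarE N'_trig // mulr0 subr0.
    by rewrite -val_eqE (ltn_eqF ij) mul0r.
  rewrite (bigD1 k) //= mxE HbarE eqxx leqnn !mul1r; congr (_ * _).
  apply: eq_bigr => i ik; rewrite mxE /= HbarE eqxx /=.
  case: ltngtP => [ik'|ki'|/val_inj ki]; last by rewrite ki eqxx in ik.
    by rewrite mul0r mul1r sub0r.
  by rewrite mul0r mul1r subr0.
pose g := \prod_(i < p | i != k) (if (i < k)%N then - (d i)%:P else 'X).
have gk : g.[d k] != 0.
  rewrite horner_prod; apply/prodf_neq0 => i _.
  by case: ifP; rewrite !hornerE // oppr_eq0.
have [r r0 hr] : exists2 r : {fps F}, r`[0] = d k & h.[r] = 0.
  apply: hensel; first by rewrite hbarE !hornerE subrr mul0r.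
  by rewrite hbarE derivM !derivE !hornerE subrr mul0r addr0.
exists (X ^+ e k * r); split.
(* The powers q^(lo i) divided out of the rows reappear as a diagonal factor. *)
- have -> : (X ^+ e k * r)%:M - N =
      diag_mx (\row_i X ^+ lo i) *m map_mx (horner_eval r) H.
    apply/matrixP => i j; rewrite mul_diag_mx !mxE /horner_eval {1}NE mxE.
    rewrite !hornerE mulrBr !mulrA -!exprD.
    have -> : (lo i + (e i - lo i) = e i)%N by rewrite subnKC ?geq_minl.
    congr (_ - _); case: eqP => _ /=; last first.
      by rewrite horner0 mulr0 !mul0r.
    by rewrite hornerC mulr1 -exprD subnKC ?geq_minr.
  by rewrite det_mulmx det_map_mx /= /horner_eval hr mulr0.
- by move=> m mk; rewrite coeffXnM mk.
- by rewrite coeffXnM ltnn subnn r0.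
Qed.

(** Take determinants in (x - A) P = P (x - B) and cancel det P in the domain. *)
Lemma det_intertwined (D : idomainType) p (A B P : 'M[D]_p) (x : D) :
  \det P != 0 -> A *m P = P *m B -> \det (x%:M - B) = 0 -> \det (x%:M - A) = 0.
Proof.
move=> P0 AP Bx; apply/eqP.
have : \det ((x%:M - A) *m P) = \det (P *m (x%:M - B)).
  by rewrite mulmxBl mulmxBr AP scalar_mxC.
by rewrite !det_mulmx Bx mulr0 => /eqP; rewrite mulf_eq0 (negPf P0) orbF.
Qed.

(** The series have pairwise different orders [e k]. *)
Lemma fps_order_inj (R : comNzRingType) p (e : nat -> nat)
    (mu : 'I_p -> {fps R}) :
  {mono e : i j / (i <= j)%N} ->
  (forall (k : 'I_p) m, (m < e k)%N -> (mu k)`[m] = 0) ->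
  (forall k : 'I_p, (mu k)`[e k] != 0) ->
  injective mu.
Proof.
move=> e_mono mu_low mu_lead.
have neq (i j : 'I_p) : (i < j)%N -> mu i <> mu j.
  move=> ij ijE; have := mu_lead i; rewrite ijE mu_low ?eqxx //.
  by rewrite ltnNge e_mono -ltnNge.
move=> i j ijE; apply: val_inj; case: (ltngtP i j) => // ij.
  by case: (neq i j).
by case: (neq j i).
Qed.

(** * Positive definite matrices *)

(** Symmetric Gaussian elimination: split off the positive corner entry and recurse on its Schur
    complement. Unlike the Cholesky factorization it takes no square roots, so it stays over the
    rationals. *)
Lemma posdef_LDL (F : numFieldType) p (G : 'M[F]_p) :
  G^T = G -> (forall x : 'rV_p, x != 0 -> 0 < (x *m G *m x^T) 0 0) ->
  exists (L : 'M[F]_p) (d : 'rV[F]_p),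
    [/\ is_trig_mx L, forall i, L i i = 1, forall i, d 0 i != 0
      & G = L *m diag_mx d *m L^T].
Proof.
elim: p G => [|p IHp] G Gsym Gpos.
  by exists 1%:M, 0; split;
    [rewrite scalar_mx_is_trig|case|case|rewrite !thinmx0].
change ('M[F]_(1 + p)) in G; pose b := ursubmx G; pose g := G 0 0.
have ulG : ulsubmx G = g%:M.
  by apply/matrixP => i j; rewrite !ord1 !mxE eqxx !lshift0.
have dlG : dlsubmx G = b^T by rewrite /b trmx_ursub Gsym.
have GE : G = block_mx g%:M b b^T (drsubmx G) by rewrite -ulG -dlG submxK.
have g_gt0 : 0 < g.
  have := Gpos (delta_mx 0 0); rewrite trmx_delta -rowE -colE !mxE; apply.
  by apply/eqP => /matrixP/(_ 0 0)/eqP; rewrite !mxE eqxx oner_eq0.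
have g_neq0 : g != 0 by rewrite gt_eqF.
pose S := drsubmx G - g^-1 *: (b^T *m b).
have Ssym : S^T = S.
  by rewrite /S linearB linearZ /= trmx_mul trmxK -{1}Gsym trmx_drsub trmxK.
have Spos (y : 'rV_p) : y != 0 -> 0 < (y *m S *m y^T) 0 0.
  (* This [t] makes the first entry of (t, y) G vanish, so the form of [G] at (t, y) equals that of
     [S] at [y]. *)
  move=> y0; pose t := - g^-1 *: (y *m b^T).
  have <- : row_mx t y *m G *m (row_mx t y)^T = y *m S *m y^T.
    rewrite [in LHS]GE mul_row_block mul_mx_scalar scalerA mulrN divff //.
    rewrite scaleN1r addNr /S mulmxBr -scalemxAr mulmxA /t -scalemxAl scaleNr.
    by rewrite [_ + y *m _]addrC tr_row_mx mul_row_col mul0mx add0r.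
  apply: Gpos; apply: contra y0 => /eqP/(congr1 (@rsubmx _ _ 1 _)).
  by rewrite row_mxKr linear0 => ->.
have [L [d [Ltrig L1 d0 SE]]] := IHp S Ssym Spos.
pose M : 'M_(1 + p) := block_mx 1%:M 0 (g^-1 *: b^T) L.
have Mtrig (i j : 'I_(1 + p)) : (i < j)%N -> M i j = 0.
  rewrite /M; case: (split_ordP i) => i' ->; case: (split_ordP j) => j' ->.
  - by rewrite !ord1.
  - by rewrite block_mxEur mxE.
  - by rewrite !ord1.
  - by rewrite block_mxEdr /= ltn_add2l; apply: (is_trig_mxP Ltrig).
have M1 (i : 'I_(1 + p)) : M i i = 1.
  rewrite /M; case: (split_ordP i) => i' ->; last by rewrite block_mxEdr L1.
  by rewrite block_mxEul !ord1 mxE.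
have d'0 (i : 'I_(1 + p)) : row_mx g%:M d 0 i != 0.
  case: (split_ordP i) => i' ->; last by rewrite row_mxEr d0.
  by rewrite row_mxEl !ord1 mxE.
suff GM : G = M *m diag_mx (row_mx g%:M d) *m M^T.
  by exists M, (row_mx g%:M d); split=> //; apply/is_trig_mxP.
rewrite /M diag_mx_row tr_block_mx !mulmx_block !(mulmx0, mul0mx, addr0, add0r).
rewrite trmx1 !mul1mx !mulmx1 trmx0 !linear0 ?mul0mx ?addr0.
have -> : diag_mx (g%:M : 'rV_1) = g%:M.
  by apply/matrixP => i j; rewrite !ord1 !mxE eqxx.
rewrite [LHS]GE -SE linearZ /= trmxK.
congr block_mx; first by rewrite mul_scalar_mx scalerA divff // scale1r.
- by rewrite mul_mx_scalar scalerA divff // scale1r.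
- by rewrite -scalemxAr mul_mx_scalar !scalerA divff // scale1r addrC subrK.
Qed.

(** * The polynomials P_m at the nodes of the eigenvectors *)

Definition kummer_coef (l k : nat) : rat := 8 ^+ k * (l ^_ k)%:R / (2 * k)`!%:R.

(* The coefficient of t^m in e^t G(t), where the sequence a_k = kummer_coef l k
   of coefficients of 1F1(-l; 1/2; -2t) is weighted by g to form G. *)
Definition kummer_sum (g : nat -> rat) (l m : nat) : rat :=
  \sum_(k < m.+1) g k * kummer_coef l k / (m - k)`!%:R.

(* This is 2^m P_m(-i(1/2 + 2 l)) / sqrt (2m)!. *)
Definition kummer (l m : nat) : rat := kummer_sum (fun=> 1) l m.

Lemma factS_rat n : (n.+1)`!%:R = n.+1%:R * n`!%:R :> rat.
Proof. by rewrite factS natrM. Qed.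

Lemma fact_neq0 n : n`!%:R != 0 :> rat.
Proof. by rewrite pnatr_eq0 -lt0n fact_gt0. Qed.

(** The ratio of consecutive hypergeometric coefficients, with denominators cleared. *)
Lemma kummer_coefS l k : (k.+1%:R * (2 * k + 1)%:R) * kummer_coef l k.+1 =
  4 * (l%:R - k%:R) * kummer_coef l k.
Proof.
rewrite /kummer_coef (_ : (2 * k.+1 = (2 * k + 1).+1)%N); last lia.
rewrite ffactnSr natrM factS_rat addn1 factS_rat exprS.
(* For k > l both sides vanish, so the truncated subtraction does no harm. *)
have -> : (l ^_ k)%:R * (l - k)%:R = (l ^_ k)%:R * (l%:R - k%:R) :> rat.
  case: (leqP k l) => [/natrB->//|lk].
  by rewrite ffact_small // !mul0r.
have f0 := fact_neq0 (2 * k)%N.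
rewrite -!natr1 natrM.
have k1 : k%:R + 1 != 0 :> rat by rewrite natr1 pnatr_eq0.
have k2 : 2 * k%:R + 1 != 0 :> rat by rewrite -natrM natr1 pnatr_eq0.
field; rewrite f0 k2 (_ : _ + 1 + 1 = 2 * (k%:R + 1)) ?mulf_neq0 //; ring.
Qed.

(** With theta = t d/dt, this is the coefficient of t^(m+1) in theta (e^t G) = e^t theta G + t e^t
    G; it comes from m + 1 = k + (m + 1 - k). *)
Lemma kummer_sumS g l m :
  m.+1%:R * kummer_sum g l m.+1 =
  kummer_sum (fun k => k%:R * g k) l m.+1 + kummer_sum g l m.
Proof.
have -> : kummer_sum g l m = \sum_(k < m.+2)
    (m.+1 - k)%:R * (g k * kummer_coef l k / (m.+1 - k)`!%:R).
  rewrite big_ord_recr /= subnn mul0r addr0; apply: eq_bigr => k _.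
  have km : (k <= m)%N by rewrite -ltnS.
  rewrite subSn // factS_rat; have nz := fact_neq0 (m - k).
  have nz' : (m - k).+1%:R != 0 :> rat by rewrite pnatr_eq0.
  by field; rewrite nz nat1r nz'.
rewrite /kummer_sum mulr_sumr -big_split; apply: eq_bigr => k _ /=.
rewrite natrB; last by rewrite -ltnS.
by ring.
Qed.

(** The equation theta (2 theta - 1) G = 4 t (l - theta) G multiplied by e^t, at t^(m+1). The
    weights [k%:R * 1] have the form that [kummer_sumS] produces. *)
Lemma kummer_sum_ode l m :
  2 * kummer_sum (fun k => k%:R * k%:R) l m.+1 -
    kummer_sum (fun k => k%:R * 1) l m.+1 =
  4 * l%:R * kummer l m - 4 * kummer_sum (fun k => k%:R * 1) l m.
Proof.
rewrite /kummer /kummer_sum !mulr_sumr -!sumrB big_ord_recl /=.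
rewrite !mul0r mulr0 subrr add0r; apply: eq_bigr => k _.
rewrite /bump /= add1n subSS.
transitivity (((k.+1%:R * (2 * k + 1)%:R) * kummer_coef l k.+1) / (m - k)`!%:R).
  by rewrite natrD natrM -natr1; ring.
by rewrite kummer_coefS; ring.
Qed.

Lemma kummer0 l : kummer l 0 = 1.
Proof.
by rewrite /kummer /kummer_sum big_ord1 /kummer_coef ffactn0 !mul1r.
Qed.

Lemma kummer1 l : kummer l 1 = 4 * l%:R + 1.
Proof.
have := kummer_sumS (fun=> 1) l 0; have := kummer_sum_ode l 0.
have sumE : kummer_sum (fun k => k%:R * k%:R) l 1 =
    kummer_sum (fun k => k%:R * 1) l 1.
  by rewrite /kummer_sum !big_ord_recl !big_ord0 /= !mul0r.
rewrite sumE (_ : kummer_sum _ l 0 = 0); last first.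
  by rewrite /kummer_sum big_ord1 /= !mul0r.
rewrite -/(kummer l 1) -/(kummer l 0) kummer0 mulr1 mulr0 subr0 mul1r => + ->.
by move=> <-; ring.
Qed.

(* For the unweighted G and theta = t d/dt, the equation
   theta (2 theta - 1) G = 4 t (l - theta) G (kummer_coefS) becomes
   theta (2 theta - 1) F = ((4 l + 1) t + 2 t^2) F for F = e^t G. *)
Lemma kummer_rec l m :
  m.+2%:R * (2 * m + 3)%:R * kummer l m.+2 =
  (4 * l%:R + 1) * kummer l m.+1 + 2 * kummer l m.
Proof.
have e0 := kummer_sumS (fun=> 1) l m.+1.
have e1 := kummer_sumS (fun k => k%:R * 1) l m.+1.
have e2 := kummer_sumS (fun=> 1) l m.
have e3 := kummer_sum_ode l m.+1.
have sq : kummer_sum (fun k => k%:R * (k%:R * 1)) l m.+2 =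
    kummer_sum (fun k => k%:R * k%:R) l m.+2.
  by apply: eq_bigr => k _; rewrite mulr1.
rewrite sq -/(kummer l _) in e0 e1 e2 *.
(* [e0], [e1] and [e2] express the sums weighted by k and k^2 through [kummer]; then [e3] becomes
   the recurrence. *)
move/eqP: e0; rewrite -subr_eq => /eqP aE; rewrite -aE in e1 e3.
move/eqP: e2; rewrite -subr_eq => /eqP bE; rewrite -bE in e1 e3.
move/eqP: e1; rewrite -subr_eq => /eqP kkE.
apply/eqP; rewrite -subr_eq0; move/eqP: e3; rewrite -kkE -subr_eq0.
by congr (_ == 0); rewrite -!/(kummer l _) natrD natrM; ring.
Qed.

(** The recurrence [kummer_rec] read in the variable x = 4 l + 1, in which degree and parity are
    visible. *)
Fixpoint kummer_poly (m : nat) : {poly rat} :=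
  match m with
  | 0 => 1
  | 1 => 'X
  | (m'.+1 as m1).+1 => (m%:R * (2 * m' + 3)%:R)^-1 *:
      ('X * kummer_poly m1 + 2 *: kummer_poly m')
  end.

Lemma kummer_polySS m : kummer_poly m.+2 = (m.+2%:R * (2 * m + 3)%:R)^-1 *:
  ('X * kummer_poly m.+1 + 2 *: kummer_poly m).
Proof. by []. Qed.

Lemma kummer_rec_neq0 m : m.+2%:R * (2 * m + 3)%:R != 0 :> rat.
Proof. by rewrite mulf_neq0 ?pnatr_eq0 // addnS. Qed.

Lemma nat_ind2 (P : nat -> Prop) :
  P 0 -> P 1 -> (forall m, P m -> P m.+1 -> P m.+2) -> forall m, P m.
Proof.
move=> P0 P1 PS m; suff: P m /\ P m.+1 by case.
by elim: m => // m [Pm Pm1]; split=> //; apply: PS.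
Qed.

Lemma kummer_polyE l m : kummer l m = (kummer_poly m).[4 * l%:R + 1].
Proof.
elim/nat_ind2: m => [||m IHm IHm1].
- by rewrite kummer0 hornerC.
- by rewrite kummer1 hornerX.
apply: (mulfI (kummer_rec_neq0 m)); rewrite kummer_rec kummer_polySS.
by rewrite hornerZ mulVKf ?kummer_rec_neq0 // !hornerE IHm IHm1.
Qed.

Lemma size_kummer_poly m : size (kummer_poly m) = m.+1.
Proof.
elim/nat_ind2: m => [||m IHm IHm1]; rewrite ?size_poly1 ?size_polyX //.
have nz : kummer_poly m.+1 != 0 by rewrite -size_poly_eq0 IHm1.
rewrite kummer_polySS size_scale ?invr_neq0 ?kummer_rec_neq0 //.
rewrite size_polyDl mulrC size_mulX ?IHm1 //.
by rewrite (leq_ltn_trans (size_scale_leq _ _)) // IHm.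
Qed.

Lemma kummer_poly_parity m (x : rat) :
  (kummer_poly m).[- x] = (-1) ^+ m * (kummer_poly m).[x].
Proof.
elim/nat_ind2: m => [||m IHm IHm1].
- by rewrite !hornerC mul1r.
- by rewrite !hornerX mulN1r.
rewrite kummer_polySS !(hornerZ, hornerD, hornerM, hornerX) IHm IHm1 !exprS.
by move: _^-1 => c; ring.
Qed.

(* By parity, a combination of the kummer_poly (ms a) vanishing at the p points
   4 l + 1 also vanishes at their opposites, hence is 0 as its degree is less
   than 2 p. *)
Lemma kummer_mx_unit p (s : bool) (ms : 'I_p -> nat) :
  injective ms -> (forall a, odd (ms a) = s) -> (forall a, (ms a < 2 * p)%N) ->
  (\matrix_(a < p, l < p) kummer l (ms a)) \in unitmx.
Proof.
move=> ms_inj ms_odd ms_lt; rewrite -row_free_unit.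
apply: inj_row_free => v v0.
pose P := \sum_a v 0 a *: kummer_poly (ms a).
pose node l : rat := 4 * l%:R + 1.
have P_node (l : 'I_p) : P.[node l] = 0.
  have /matrixP/(_ 0 l) := v0; rewrite !mxE => <-.
  rewrite horner_sum; apply: eq_bigr => a _.
  by rewrite hornerZ -kummer_polyE mxE.
have P_opp x : P.[- x] = (-1) ^+ s * P.[x].
  rewrite !horner_sum mulr_sumr; apply: eq_bigr => a _.
  by rewrite !hornerZ kummer_poly_parity -signr_odd ms_odd mulrCA.
have node_inj : injective (fun l : 'I_p => node l).
  move=> l l' /addIr /mulfI ll'; apply/val_inj/eqP.
  by rewrite -(eqr_nat rat) ll'.
have opp_inj : injective (fun l : 'I_p => - node l).
  by move=> l l' /oppr_inj /node_inj.
have node_gt0 l : 0 < node l by rewrite ltr_wpDl // mulr_ge0 // ler0n.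
(* The nodes are positive, so they and their opposites are 2 p distinct roots. *)
pose rs := [seq node l | l : 'I_p] ++ [seq - node l | l : 'I_p].
have P0 : P = 0.
  apply/eqP/negP => /negP nz; have : (size rs < size P)%N.
    apply: max_poly_roots => //.
      rewrite all_cat; apply/andP; split; apply/allP => _ /mapP[l _ ->].
        by rewrite /root P_node.
      by rewrite /root P_opp P_node mulr0.
    rewrite cat_uniq (map_inj_uniq node_inj) (map_inj_uniq opp_inj).
    rewrite enum_uniq andbT /=; apply/hasPn => _ /mapP[l _ ->]; apply/negP.
    case/mapP=> l' _ ll'; have := node_gt0 l'; rewrite -ll' oppr_gt0.
    by rewrite ltNge ltW.
  apply/negP; rewrite -leqNgt size_cat !size_map -enumT size_enum_ord.
  rewrite addnn -mul2n.
  apply: leq_trans (size_sum _ _ _) _; apply/bigmax_leqP => a _.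
  by apply: leq_trans (size_scale_leq _ _) _; rewrite size_kummer_poly.
apply/rowP => a0; rewrite mxE; apply/eqP/negP => /negP va0.
(* The degrees [ms a] are distinct, so the leading term of the largest one with nonzero coefficient
   cannot cancel. *)
case: (@arg_maxnP _ a0 (fun a => v 0 a != 0) ms va0) => a va a_max.
have := congr1 (fun q : {poly rat} => q`_(ms a)) P0; rewrite coef_sum coef0.
rewrite (bigD1 a) //= big1 ?addr0 => [|b ba].
  rewrite coefZ => /eqP; rewrite mulf_eq0 (negPf va) /=.
  have : lead_coef (kummer_poly (ms a)) != 0.
    by rewrite lead_coef_eq0 -size_poly_eq0 size_kummer_poly.
  by rewrite lead_coefE size_kummer_poly => /negPf->.
rewrite coefZ; have [->|vb] := eqVneq (v 0 b) 0; first by rewrite mul0r.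
rewrite nth_default ?mulr0 // size_kummer_poly.
have := a_max b vb; rewrite /= leq_eqVlt => /orP[/eqP/ms_inj bE|//].
by rewrite bE eqxx in ba.
Qed.

(** * Reduction to a graded rational matrix *)

(* With G = L D L^T the Gram matrix of v 0, ..., v (p - 1), the columns of
   T = V L^-T are orthogonal and v l only involves the first l + 1 of them, so
   in the basis T the entries (k, i) only involve the terms l >= max (k, i). *)
Lemma lambert_sum_graded (F : realFieldType) p (v : nat -> 'cV[F]_p)
    (w : 'rV[F]_p) (gam : nat -> F) :
  (\matrix_(a, l < p) v l a 0) \in unitmx -> (forall a, 0 < w 0 a) ->
  (forall l, gam l != 0) ->
  exists (T : 'M[F]_p) (N : 'M[{fps F}]_p),
    [/\ T \in unitmx,
        forall (i k : 'I_p) j, (j < 2 * maxn i k + 1)%N -> (N i k)`[j] = 0,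
        forall i : 'I_p, (N i i)`[2 * i + 1] != 0
      & forall a i j, \sum_k T a k * (N k i)`[j] =
          \sum_b (\sum_(l < j.+1) gam l * (v l a 0 * v l b 0) *
             ((0 < j) && (2 * l + 1 %| j))%N%:R) * w 0 b * T b i].
Proof.
set V := \matrix_(a, l < p) _ => V_unit w_gt0 gam_neq0.
have [||L [d [/is_trig_mxP Ltrig L1 d_neq0 GE]]] :=
  @posdef_LDL F p (V^T *m diag_mx w *m V).
- by rewrite !trmx_mul tr_diag_mx trmxK mulmxA.
- move=> x x0; set y := x *m V^T.
  have -> : x *m (V^T *m diag_mx w *m V) *m x^T = y *m diag_mx w *m y^T.
    by rewrite /y trmx_mul trmxK !mulmxA.
  have y0 : y != 0.
    apply: contra x0 => /eqP/(congr1 (mulmx^~ (invmx V^T))).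
    by rewrite mulmxK ?unitmx_tr // mul0mx => ->.
  have yE : (y *m diag_mx w *m y^T) 0 0 = \sum_b w 0 b * y 0 b ^+ 2.
    rewrite mul_mx_diag mxE; apply: eq_bigr => b _.
    rewrite [(\matrix_(_, _) _) _ _]mxE [y^T _ _]mxE; ring.
  have [b yb] : exists b, y 0 b != 0.
    apply/existsP; apply: contraNT y0 => /existsPn y0; apply/eqP/rowP => b.
    by rewrite [RHS]mxE; apply/eqP/negPn/y0.
  rewrite yE (bigD1 b) //= ltr_pwDl //.
    by rewrite mulr_gt0 // exprn_even_gt0.
  by apply: sumr_ge0 => b' _; rewrite mulr_ge0 ?sqr_ge0 // ltW.
have L_unit : L \in unitmx.
  rewrite unitmxE det_trig; last exact/is_trig_mxP.
  by rewrite big1 ?unitr1.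
pose T := V *m invmx L^T.
have T_unit : T \in unitmx by rewrite unitmx_mul V_unit unitmx_inv unitmx_tr.
have VE : V = T *m L^T by rewrite mulmxKV ?unitmx_tr.
(* Coordinates of [v l] in the basis [T], for every l; for l < p they form row l of [L]. *)
pose al l := invmx T *m v l.
have vE l : v l = T *m al l by rewrite mulKVmx.
have alE (l i : 'I_p) : al l i 0 = L l i.
  have -> : al l = col l L^T; last by rewrite !mxE.
  apply: (can_inj (mulKmx T_unit)); rewrite -vE colE mulmxA -VE -colE.
  by apply/matrixP => a j; rewrite !mxE ord1.
have al0 l (i : 'I_p) : (l < i)%N -> al l i 0 = 0.
  move=> li; have lp := ltn_trans li (ltn_ord i).
  by rewrite (alE (Ordinal lp)) Ltrig.
(* The columns of [T] are orthogonal for the weight [w], with squared norms [d]. *)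
have orth : T^T *m diag_mx w *m T = diag_mx d.
  have LT_unit : L^T \in unitmx by rewrite unitmx_tr.
  apply: (can_inj (mulKmx L_unit)); apply: (can_inj (mulmxK LT_unit)).
  by rewrite /= -GE VE !trmx_mul trmxK !mulmxA.
have vwT l i : \sum_b v l b 0 * w 0 b * T b i = al l i 0 * d 0 i.
  transitivity (((v l)^T *m diag_mx w *m T) 0 i).
    by rewrite mul_mx_diag mxE; apply: eq_bigr => b _; rewrite !mxE.
  have -> : (v l)^T *m diag_mx w *m T = (al l)^T *m diag_mx d.
    by rewrite -orth [in LHS]vE trmx_mul !mulmxA.
  by rewrite mul_mx_diag mxE [(al l)^T _ _]mxE.
pose N := \matrix_(k, i) (Fps (fun j => \sum_(l < j.+1)
  gam l * (al l k 0 * (al l i 0 * d 0 i)) *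
    ((0 < j) && (2 * l + 1 %| j))%N%:R) : {fps F}).
exists T, N; split=> //.
- move=> i k j jik; rewrite mxE /= big1 // => l _.
  case: andP => [[j0 lj]|]; last by rewrite mulr0.
  (* A contributing l satisfies 2 l + 1 <= j < 2 max (i, k) + 1. *)
  have : (l < i)%N || (l < k)%N by have := dvdn_leq j0 lj; lia.
  by case/orP => /al0->; rewrite !(mul0r, mulr0).
- move=> i; have ij : (i < (2 * i + 1).+1)%N by lia.
  have j_gt0 : (0 < 2 * i + 1)%N by rewrite addn1.
  (* Only l = i survives: [al0] kills l < i, and for l > i the number 2 l + 1 is too large to divide
     2 i + 1. *)
  rewrite mxE /= (bigD1 (Ordinal ij)) //= dvdnn j_gt0 big1 ?addr0.
    by rewrite !alE L1 !mul1r mulr1 mulf_neq0.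
  move=> l; rewrite -val_eqE /= neq_ltn => /orP[/al0->|il].
    by rewrite !(mul0r, mulr0).
  by rewrite gtnNdvd ?mulr0 //; lia.
move=> a i j; rewrite /N.
under eq_bigr do rewrite mxE /= mulr_sumr.
under [RHS]eq_bigr do rewrite -mulrA mulr_suml.
rewrite exchange_big [RHS]exchange_big; apply: eq_bigr => l _ /=.
transitivity (gam l * ((0 < j) && (2 * l + 1 %| j))%N%:R * v l a 0 *
  (al l i 0 * d 0 i)).
  have -> : v l a 0 = \sum_k T a k * al l k 0 by rewrite {1}vE mxE.
  rewrite -mulrA mulr_suml mulr_sumr.
  by apply: eq_bigr => k _; ring.
by rewrite -vwT mulr_sumr; apply: eq_bigr => b _; ring.
Qed.

(** The coordinates s, s + 2, ..., m already number [m./2 + 1]. This supplies the degree bound of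
    [kummer_mx_unit]. *)
Lemma Hcoords_ltn_card n s (m : 'I_n.+1) : m \in Hcoords n s ->
  (m < 2 * #|Hcoords n s|)%N.
Proof.
rewrite inE => /eqP ms.
have mE := odd_double_half m; rewrite ms in mE.
pose f (i : 'I_(m./2.+1)) : 'I_n.+1 := inord (s + i.*2).
have fE i : f i = (s + i.*2)%N :> nat.
  by rewrite inordK //; have := ltn_ord i; have := ltn_ord m; lia.
have f_inj : injective f.
  by move=> i j /(congr1 val) /=; rewrite !fE => ij; apply: val_inj => /=; lia.
have : (#|[set f i | i : 'I_(m./2.+1)]| <= #|Hcoords n s|)%N.
  apply/subset_leq_card/subsetP => _ /imsetP[i _ ->].
  by rewrite inE fE oddD odd_double addbF; case: (s).
rewrite card_imset // card_ord; lia.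
Qed.

(** * The operator in rational coordinates *)

Section Operator.
Variables (C : numClosedFieldType) (n : nat) (s : bool).
Let p := #|Hcoords n s|.
Let coord (a : 'I_p) : nat := enum_val a.

Definition eta_rat (l : nat) : 'cV[rat]_p :=
  \col_a ((2 ^+ coord a)^-1 * kummer l (coord a)).

Let sq (a : 'I_p) : C := sqrtC (2 * coord a)`!%:R.

Lemma eta_pmE l (a : 'I_p) :
  eta_pm C n s l (enum_val a) 0 = sq a * ratr (eta_rat l a 0).
Proof.
have aH := enum_valP a; rewrite mxE.
have -> : (1 + (-1) ^+ s * (-1) ^+ enum_val a) / 2 = 1 :> C.
  move: aH; rewrite inE => /eqP aH.
  rewrite -[in (-1) ^+ enum_val a]signr_odd aH.
  by rewrite -expr2 sqrr_sign -[1 + 1]mulr2n divff // pnatr_eq0.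
rewrite mul1r etaE -/(coord a) /sq mxE; congr (_ * _).
rewrite rmorphM fmorphV rmorphXn rmorph_nat /kummer /kummer_sum rmorph_sum.
rewrite mulr_sumr; apply: eq_bigr => k _ /=.
rewrite /kummer_coef !rmorphM !fmorphV !rmorph_nat rmorphXn rmorph_nat rmorph1.
rewrite expfzDr ?pnatr_eq0 // -exprnP exprnN exprM.
have -> : 8 = 2 ^+ 3 :> C by rewrite -natrX.
by move: (2 ^+ 3 ^+ k) (2 ^ (- _)) => x y; rewrite invfM; ring.
Qed.

(** Removes the conjugation in [ketbra]: the entry is a real square root times a rational. *)
Lemma conj_eta_pm l (a : 'I_p) :
  (eta_pm C n s l (enum_val a) 0)^* = eta_pm C n s l (enum_val a) 0.
Proof.
rewrite eta_pmE; apply: conj_Creal; apply: realM.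
  by rewrite ger0_real // sqrtC_ge0 ler0n.
by rewrite realE ler0q lerq0 le_total.
Qed.

Lemma eta_rat_unit : (\matrix_(a, l < p) eta_rat l a 0) \in unitmx.
Proof.
have ms_inj : injective coord by move=> a b /val_inj /enum_val_inj.
have ms_odd a : odd (coord a) = s.
  by have := enum_valP a; rewrite inE => /eqP.
have ms_lt a : (coord a < 2 * p)%N by apply/Hcoords_ltn_card/enum_valP.
have -> : \matrix_(a, l < p) eta_rat l a 0 =
    diag_mx (\row_a (2 ^+ coord a)^-1) *m \matrix_(a, l < p) kummer l (coord a).
  by apply/matrixP => a l; rewrite mul_diag_mx !mxE.
rewrite unitmx_mul (kummer_mx_unit ms_inj ms_odd ms_lt) andbT unitmxE det_diag.
rewrite unitfE; apply/prodf_neq0 => a _; rewrite mxE invr_eq0.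
by rewrite expf_neq0.
Qed.

(** Since 2^(3/2) = 2 sqrt 2, leaving out one factor sqrt 2 makes the weight rational. *)
Definition weight_rat (l : nat) : rat :=
  (-1) ^+ s * 2 * ((- 4) ^- l * 'C(2 * l, l)%:R).

Lemma weight_rat_neq0 l : weight_rat l != 0.
Proof.
rewrite !mulf_neq0 ?signr_eq0 ?invr_eq0 ?expf_neq0 //.
by rewrite pnatr_eq0 -lt0n bin_gt0; lia.
Qed.

Lemma coeff_calA (a b : 'I_p) j : (calA C n s a b)`[j] =
  sqrtC 2 * (sq a * sq b * ratr (\sum_(l < j.+1)
    weight_rat l * (eta_rat l a 0 * eta_rat l b 0) *
      ((0 < j) && (2 * l + 1 %| j))%N%:R)).
Proof.
rewrite mxE (coeff_calA_full _ _ _ _ (ltnSn j)) rmorph_sum !mulr_sumr.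
apply: eq_bigr => l _ /=; rewrite conj_eta_pm !eta_pmE.
have -> : sqrtC 2 ^+ 3 = 2 * sqrtC 2 :> C by rewrite exprSr sqrtCK.
have -> : alpha C l = ratr ((- 4) ^- l * 'C(2 * l, l)%:R).
  by rewrite /alpha rmorphM fmorphV rmorphXn rmorphN !rmorph_nat.
rewrite /weight_rat !rmorphM rmorph_sign !rmorph_nat.
ring.
Qed.

Lemma calA_eigenvalues : exists lam : 'I_p -> {fps C},
  [/\ has_eigenvalues (calA C n s) lam,
      forall (k : 'I_p) (j : nat), (j < 2 * k + 1)%N -> (lam k)`[j] = 0
    & forall (k : 'I_p) (j : nat),
        exists r : rat, (lam k)`[j] = ratr r * sqrtC 2].
Proof.
(* Conjugation by diag (sqrt (2m)!) turns sqrt (2a)! sqrt (2b)! in entry (a, b) into the rational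
   column weight (2b)!. *)
pose w : 'rV[rat]_p := \row_a (2 * coord a)`!%:R.
have w_gt0 a : 0 < w 0 a by rewrite mxE ltr0n fact_gt0.
have [T [N [T_unit N_low N_diag TN]]] :=
  lambert_sum_graded eta_rat_unit w_gt0 weight_rat_neq0.
pose e k := (2 * k + 1)%N.
have e_mono : {mono e : i j / (i <= j)%N} by move=> i j; rewrite /e; lia.
have /fin_all_exists[mu muP] := graded_eigenvalue e_mono N_low N_diag.
pose c := sqrtC 2 : C; have c0 : c != 0 by rewrite sqrtC_eq0 pnatr_eq0.
pose lam k := fpsC c * fps_map ratr (mu k) : {fps C}.
have lamE k j : (lam k)`[j] = c * ratr (mu k)`[j] by rewrite coeffCM.
exists lam; split; last 2 first.
- move=> k j jk; have [_ mu0 _] := muP k. 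
  by rewrite lamE mu0 ?rmorph0 ?mulr0.
- by move=> k j; exists (mu k)`[j]; rewrite lamE mulrC.
(* The basis [T] in the original coordinates; there [calA] acts as [B], that is sqrt 2 times [N]. *)
pose P0 : 'M[C]_p := diag_mx (\row_a sq a) *m map_mx ratr T.
pose B := fpsC c *: map_mx (fps_map ratr) N.
have sq_neq0 a : sq a != 0 by rewrite sqrtC_eq0 pnatr_eq0 -lt0n fact_gt0.
apply: distinct_roots_eigenvalues.
  apply: (@fps_order_inj _ _ _ lam e_mono) => [k m mk|k];
    rewrite lamE; have [_ mu0 mu1] := muP k.
    by rewrite mu0 // rmorph0 mulr0.
  by rewrite mulf_neq0 ?fmorph_eq0.
move=> k; apply: (@det_intertwined _ _ _ B (map_mx (@fpsC C) P0)).
- rewrite det_map_mx /P0 det_mulmx det_diag det_map_mx.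
  (* The determinant is a constant series, so its constant term decides. *)
  suff: \prod_i (\row_a sq a) 0 i * ratr (\det T) != 0.
    by apply: contra => /eqP/(congr1 (fun f => f`[0])) /= ->.
  rewrite mulf_neq0 ?fmorph_eq0 -?unitfE -?unitmxE //.
  by rewrite unitfE; apply/prodf_neq0 => a _; rewrite mxE.
- have PE a i : map_mx (@fpsC C) P0 a i = fpsC (sq a * ratr (T a i)).
    by rewrite /P0 mul_diag_mx !mxE.
  have BE a i j : (B a i)`[j] = c * ratr (N a i)`[j] by rewrite !mxE coeffCM.
  apply/matrixP => a i; apply/fpsP => j.
  rewrite [(calA _ _ _ *m _) _ _]mxE [(_ *m B) _ _]mxE !coeff_sum.
  transitivity (c * sq a * ratr (\sum_b (\sum_(l < j.+1)
      weight_rat l * (eta_rat l a 0 * eta_rat l b 0) *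
        ((0 < j) && (2 * l + 1 %| j))%N%:R) * w 0 b * T b i)).
    rewrite rmorph_sum mulr_sumr; apply: eq_bigr => b _.
    rewrite mulrC PE coeffCM coeff_calA [w 0 b]mxE !rmorphM rmorph_nat.
    have -> : (2 * coord b)`!%:R = sq b * sq b :> C by rewrite -expr2 sqrtCK.
    by rewrite /c; ring.
  rewrite -TN rmorph_sum mulr_sumr; apply: eq_bigr => b _.
  by rewrite PE coeffCM BE rmorphM; ring.
- have -> : (lam k)%:M - B = fpsC c *: map_mx (fps_map ratr) ((mu k)%:M - N).
    apply/matrixP => a i; rewrite !mxE rmorphB /= mulrBr; congr (_ - _).
    by case: eqP => _; rewrite ?mulr1n // !mulr0n rmorph0 mulr0.
  by have [mu0 _ _] := muP k; rewrite detZ det_map_mx mu0 rmorph0 mulr0.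
Qed.

End Operator.

Theorem theorem6p5 (R : realType) (n : nat) (s : bool) :
  let d := \dim (Hspace R[i] n s) in
  exists lam : 'I_d -> {fps R[i]},
    [/\ has_eigenvalues (calA R[i] n s) lam,
        forall (k : 'I_d) (j : nat), (j < 2 * k + 1)%N -> (lam k)`[j] = 0
      & forall (k : 'I_d) (j : nat),
          exists r : rat, (lam k)`[j] = ratr r * sqrtC 2].
Proof. by move=> d; rewrite /d dim_Hspace; apply: calA_eigenvalues. Qed.
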